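(* Let $\mu_1,\mu_2,\mu_3\in\mathbb{R}$, $\sigma_1,\sigma_2,\sigma_3>0$ and $k>0$. Consider three stocks with positive prices $p_{it}$, $i=1,2,3$, at discrete times $t=0,1,2,\dots$, with deterministic equal initial log-prices $\log p_{10}=\log p_{20}=\log p_{30}$ and $$\log(p_{i,t+1})=\log(p_{it})+\mu_i+\delta_{i,t+1},$$ where all $\delta_{it}$ are independent with $\delta_{it}\sim N(0,\sigma_i^2)$. Define spreads $$\epsilon_{at}=\log(p_{2t})-\log(p_{1t})-(\mu_2-\mu_1)t,\qquad \epsilon_{bt}=\log(p_{3t})-\log(p_{1t})-(\mu_3-\mu_1)t,$$ with standard deviations $\sigma_a=\sqrt{t(\sigma_1^2+\sigma_2^2)}$ and $\sigma_b=\sqrt{t(\sigma_1^2+\sigma_3^2)}$, signals $$S_{at}=\mathbb{1}\{\epsilon_{at}\le -k\sigma_a\}-\mathbb{1}\{\epsilon_{at}\ge k\sigma_a\},\qquad S_{bt}=\mathbb{1}\{\epsilon_{bt}\le -k\sigma_b\}-\mathbb{1}\{\epsilon_{bt}\ge k\sigma_b\},$$ stock returns $r_{i,t+1}=p_{i,t+1}/p_{it}-1$, and pair returns $r_{a,t+1}=S_{at}(r_{2,t+1}-r_{1,t+1})$, $r_{b,t+1}=S_{bt}(r_{3,t+1}-r_{1,t+1})$. Let $(Z_a,Z_b)$ be zero-mean jointly normal with unit variances and correlation $\rho=\sigma_1^2/\sqrt{(\sigma_1^2+\sigma_2^2)(\sigma_1^2+\sigma_3^2)}$. Then for every $t\ge1$,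 $$\operatorname{Cov}(r_{a,t+1},r_{b,t+1})=2\Big(\mathbf{P}(Z_a\ge k,\,Z_b\ge k)-\mathbf{P}(Z_a\ge k,\,Z_b\le -k)\Big)\Big(e^{\mu_2+\mu_3+\sigma_2^2/2+\sigma_3^2/2}-e^{\mu_1+\mu_3+\sigma_1^2/2+\sigma_3^2/2}-e^{\mu_1+\mu_2+\sigma_1^2/2+\sigma_2^2/2}+e^{2\mu_1+2\sigma_1^2}\Big).$$
   Context: Pairs $a=$ (stock 1, stock 2) and $b=$ (stock 1, stock 3) are two non-cointegrated pairs sharing stock 1; each log-price follows an independent Gaussian random walk with drift. *)

(* Defs.v *)
From HB Require Import structures.
From mathcomp Require Import all_boot all_order all_algebra.
From mathcomp Require Import all_classical all_reals all_analysis.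
Set Implicit Arguments. Unset Strict Implicit. Unset Printing Implicit Defensive.
Import Order.TTheory GRing.Theory Num.Theory.
Import numFieldNormedType.Exports.
Local Open Scope classical_set_scope.
Local Open Scope ring_scope.

Definition stk1 : 'I_3 := @Ordinal 3 0 isT.
Definition stk2 : 'I_3 := @Ordinal 3 1 isT.
Definition stk3 : 'I_3 := @Ordinal 3 2 isT.

Definition mutually_independent {d} {T : measurableType d} {R : realType}
  (P : probability T R) {I : eqType} (ok : I -> Prop) (X : I -> T -> R) :=
  forall (J : seq I) (B : I -> set R), uniq J ->
    (forall j, j \in J -> ok j /\ measurable (B j)) ->
    P [set w | forall j, j \in J -> B j (X j w)] =
    (\prod_(j <- J) P (X j @^-1` B j))%E.

Section model.
Context {d} {T : measurableType d} {R : realType}.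
Variables (c : R) (mu sigma : 'I_3 -> R) (k : R) (delta : 'I_3 -> nat -> T -> R).

Definition logprice (i : 'I_3) (t : nat) (w : T) : R :=
  c + mu i * t%:R + \sum_(1 <= s < t.+1) delta i s w.

Definition price (i : 'I_3) (t : nat) (w : T) : R := expR (logprice i t w).

Definition spread (j : 'I_3) (t : nat) (w : T) : R :=
  ln (price j t w) - ln (price stk1 t w) - (mu j - mu stk1) * t%:R.

Definition spread_sd (j : 'I_3) (t : nat) : R :=
  Num.sqrt (t%:R * (sigma stk1 ^+ 2 + sigma j ^+ 2)).

Definition signal (j : 'I_3) (t : nat) (w : T) : R :=
  (nat_of_bool (spread j t w <= - k * spread_sd j t))%:R -
  (nat_of_bool (k * spread_sd j t <= spread j t w))%:R.

Definition stock_return (i : 'I_3) (t : nat) (w : T) : R :=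
  price i t.+1 w / price i t w - 1.

Definition pair_return (j : 'I_3) (t : nat) (w : T) : R :=
  signal j t w * (stock_return j t w - stock_return stk1 t w).

End model.

Definition binormal_pdf {R : realType} (rho x y : R) : R :=
  (pi *+ 2 * Num.sqrt (1 - rho ^+ 2))^-1 *
  expR (- (x ^+ 2 - rho * x * y *+ 2 + y ^+ 2) / ((1 - rho ^+ 2) *+ 2)).

Definition binormal_prob {R : realType} (rho : R) (A : set (R * R)) : \bar R :=
  (\int[(@lebesgue_measure R) \x (@lebesgue_measure R)]_(z in A)
     (binormal_pdf rho z.1 z.2)%:E)%E.

(* Main.v *)
Require Import Defs.
From HB Require Import structures.
From mathcomp Require Import all_boot all_order all_algebra.
From mathcomp Require Import all_classical all_reals all_analysis.
From mathcomp Require Import measurable_realfun ring lra.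
Import Order.TTheory GRing.Theory Num.Theory.
Import numFieldNormedType.Exports.
Local Open Scope classical_set_scope.
Local Open Scope ring_scope.
Set Implicit Arguments.
Unset Strict Implicit.

(* Write X_i for the sum of the increments of stock i up to time t and D_i for
   its increment at time t+1. The signals at time t depend on X_1, X_2, X_3
   only, the returns at time t+1 on D_1, D_2, D_3 only, and all six variables are
   independent and normal. The pair (X_2 - X_1, X_3 - X_1), divided by its
   standard deviations (both positive or both negative), has the binormal law of
   correlation rho: integrate the product of the three normal densities over
   X_1. The freedom of sign makes that law symmetric under (x, y) |-> (-x, -y),
   so both pair returns have mean zero, and the four events on which the product
   of the signals does not vanish group into twice the difference of two
   quadrant probabilities. Expanding (R_2 - R_1) (R_3 - R_1), with R_i the
   log-normal gross returns, gives the second factor. *)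

Local Notation pushforward_measure :=
  measure_function_pushforward__canonical__measure_function_Measure.

(** * Gaussian integrals and affine changes of variables *)

Lemma normal_peakE (R : realType) (s : R) : 0 < s ->
  normal_peak s = (s * Num.sqrt (pi *+ 2))^-1.
Proof.
move=> s0; rewrite /normal_peak -mulrnAr sqrtrM ?sqr_ge0//.
by rewrite sqrtr_sqr gtr0_norm.
Qed.

Lemma sqrt2pi_neq0 (R : realType) : Num.sqrt (pi *+ 2) != 0 :> R.
Proof. by rewrite gt_eqF// sqrtr_gt0 mulrn_wgt0// pi_gt0. Qed.

(** Completing the square: up to a constant factor the integrand is the normal density of mean
    [m = - b * s ^+ 2] and deviation [s], whose total mass is 1. *)
Lemma integral_expR_quadratic (R : realType) (s b c : R) : 0 < s ->
  (\int[lebesgue_measure]_x (expR (- (x ^+ 2 / (s ^+ 2 *+ 2) + b * x + c)))%:E =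
   (s * Num.sqrt (pi *+ 2) * expR (s ^+ 2 * b ^+ 2 / 2 - c))%:E)%E.
Proof.
move=> s0; pose m := - b * s ^+ 2; have s_neq0 : s != 0 by rewrite gt_eqF.
set K := s * _ * _; have K0 : 0 <= K.
  by rewrite mulr_ge0 ?expR_ge0// mulr_ge0 ?sqrtr_ge0// ltW.
transitivity (\int[lebesgue_measure]_x (K%:E * (normal_pdf m s x)%:E))%E.
  apply: eq_integral => x _; rewrite -EFinM; congr EFin.
  rewrite normal_pdfE// normal_peakE// /normal_fun.
  have := sqrt2pi_neq0 R; move: (Num.sqrt _) @K K0 => r K _ r0.
  rewrite [RHS](_ : _ = expR (s ^+ 2 * b ^+ 2 / 2 - c) *
    expR (- (x - m) ^+ 2 / (s ^+ 2 *+ 2))).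
    by rewrite -expRD; congr expR; rewrite /m; field.
  by rewrite /K; field; rewrite r0.
rewrite ge0_integralZl_EFin//=.
- by rewrite integral_normal_pdf mule1.
- by move=> x _; rewrite lee_fin normal_pdf_ge0.
- by apply/measurable_EFinP; exact: measurable_normal_pdf.
Qed.

(** By uniqueness of Lebesgue measure: the right-hand side is a measure in [A], so half-open
    intervals suffice. For negative [a] the preimage of such an interval is closed on the other
    side, hence the two cases. *)
Lemma lebesgue_measure_affine (R : realType) (a b : R) (A : set R) : a != 0 ->
  measurable A ->
  (lebesgue_measure A =
   `|a|%:E * lebesgue_measure ((fun x : R => a * x + b)%R @^-1` A))%E.
Proof.
move=> a0 mA; pose phi : measurableTypeR R -> measurableTypeR R :=
  fun x : R => a * x + b.
have mphi : measurable_fun setT phi.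
  by apply: measurable_funD => //; apply: measurable_funM.
apply: (lebesgue_measure_unique
  (mu := mscale `|a|%:nng (pushforward_measure lebesgue_measure mphi))) => //.
move=> _ [[x y] _ <-] /=; rewrite /mscale /= /pushforward.
have [a_gt0|a_lt0] : 0 < a \/ a < 0.
  by apply/orP; rewrite orbC -neq_lt.
- have -> : phi @^-1` `]x, y] = `](x - b) / a, (y - b) / a]%classic.
    apply/seteqP; split => u /=;
      by rewrite !in_itv/= ltr_pdivrMr// ler_pdivlMr// ltrBlDr lerBrDr mulrC.
  rewrite !lebesgue_measure_itv/= !lte_fin ltr_pM2r ?invr_gt0// ltrD2r.
  case: ifP => xy; rewrite ?mule0// -!EFinD -EFinM gtr0_norm//.
  by congr EFin; field.
- have -> : phi @^-1` `]x, y] = `[(y - b) / a, (x - b) / a[%classic.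
    apply/seteqP; split => u /=;
      by rewrite !in_itv/= ltr_ndivlMr// ler_ndivrMr// ltrBlDr lerBrDr mulrC andbC.
  rewrite !lebesgue_measure_itv/= !lte_fin ltr_nM2r ?invr_lt0// ltrD2r.
  case: ifP => xy; rewrite ?mule0// -!EFinD -EFinM ltr0_norm//.
  by congr EFin; field.
Qed.

Lemma ge0_integral_affine (R : realType) (a b : R) (f : R -> \bar R) : a != 0 ->
  measurable_fun setT f -> (forall x, 0 <= f x)%E ->
  (\int[lebesgue_measure]_x f x =
   `|a|%:E * \int[lebesgue_measure]_x f (a * x + b)%R)%E.
Proof.
move=> a0 mf f0; pose phi : measurableTypeR R -> measurableTypeR R :=
  fun x : R => a * x + b.
have mphi : measurable_fun setT phi.
  by apply: measurable_funD => //; apply: measurable_funM.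
rewrite (eq_measure_integral
    (mscale `|a|%:nng (pushforward_measure lebesgue_measure mphi))); last first.
  by move=> A mA _; exact: (lebesgue_measure_affine b a0 mA).
by rewrite ge0_integral_mscale// ge0_integral_pushforward.
Qed.

(** The Radon-Nikodym derivative of [normal_prob m s] and [normal_pdf m s] have the same integral
    over every measurable set, so they agree almost everywhere. *)
Lemma ge0_integral_normal_prob (R : realType) (m s : R) (f : R -> \bar R) :
  measurable_fun setT f -> (forall x, 0 <= f x)%E ->
  (\int[normal_prob m s]_x f x =
   \int[lebesgue_measure]_x (f x * (normal_pdf m s x)%:E))%E.
Proof.
move=> mf f0; have dom := normal_prob_dominates m s.
rewrite -(Radon_Nikodym_SigmaFinite.change_of_variables dom)//.
have int := Radon_Nikodym_SigmaFinite.f_integrable dom.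
have mpdf : measurable_fun setT (fun x => (normal_pdf m s x)%:E).
  by apply/measurable_EFinP; exact: measurable_normal_pdf.
apply: ae_eq_integral => //.
- by apply: emeasurable_funM => //; exact: measurable_int int.
- exact: emeasurable_funM.
- apply: ae_eqe_mul2l; apply: integral_ae_eq => //.
  by move=> E _ mE; rewrite -Radon_Nikodym_SigmaFinite.f_integral.
Qed.

Lemma normal_probE (R : realType) (m s : R) (A : set R) : measurable A ->
  (normal_prob m s A =
   \int[lebesgue_measure]_x ((\1_A x)%:E * (normal_pdf m s x)%:E))%E.
Proof.
move=> mA; rewrite -ge0_integral_normal_prob//.
- by rewrite integral_indic// setIT.
- by apply/measurable_EFinP; exact: measurable_indic.
Qed.

Lemma integral_normal_pdfM (R : realType) (a b z : R) : 0 < a -> 0 < b ->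
  (\int[lebesgue_measure]_x (normal_pdf 0 b (z - x) * normal_pdf 0 a x)%:E =
   (normal_pdf 0 (Num.sqrt (a ^+ 2 + b ^+ 2)) z)%:E)%E.
Proof.
move=> a0 b0; set c := Num.sqrt _.
have c0 : 0 < c by rewrite sqrtr_gt0 addr_gt0// exprn_gt0.
have c2 : c ^+ 2 = a ^+ 2 + b ^+ 2 by rewrite sqr_sqrtr// addr_ge0// sqr_ge0.
have [an bn cn] : [/\ a != 0, b != 0 & c != 0] by rewrite !gt_eqF.
have c2n : a ^+ 2 + b ^+ 2 != 0 by rewrite -c2 sqrf_eq0.
have r0 := sqrt2pi_neq0 R.
rewrite !normal_pdfE// !normal_peakE// /normal_fun.
(* In [x] the exponent is quadratic, and [1 / a ^+ 2 + 1 / b ^+ 2 = (c / (a * b)) ^+ 2] gives the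
   width [a * b / c]. *)
transitivity (\int[lebesgue_measure]_x
  (((b * Num.sqrt (pi *+ 2))^-1 * (a * Num.sqrt (pi *+ 2))^-1)%:E *
   (expR (- (x ^+ 2 / ((a * b / c) ^+ 2 *+ 2) + (- z / b ^+ 2) * x +
     z ^+ 2 / (b ^+ 2 *+ 2))))%:E))%E.
  apply: eq_integral => x _; rewrite -EFinM mulrACA -expRD; congr (_ * expR _)%:E.
  by rewrite !exprMn exprVn c2; field; rewrite ?r0 ?an ?bn ?cn ?c2n.
rewrite ge0_integralZl_EFin//=.
- rewrite integral_expR_quadratic ?divr_gt0 ?mulr_gt0// -EFinM mulrA.
  congr (_ * expR _)%:E; first by field; rewrite ?r0 ?an ?bn ?cn ?c2n.
  by rewrite !exprMn exprVn c2; field; rewrite ?r0 ?an ?bn ?cn ?c2n.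
- apply/measurable_EFinP/measurableT_comp => //; apply: measurableT_comp => //.
  by apply: measurable_funD => //; apply: measurable_funD;
    apply: measurable_funM => //; exact: measurable_funX.
- by rewrite mulr_ge0// invr_ge0 mulr_ge0 ?sqrtr_ge0// ltW.
Qed.

(** Given the first variable [x], the points [al * u + x] and [be * v + x] are the values of the
    other two, and [|al|], [|be|] are the Jacobians; integrating out [x] leaves the joint density of
    the scaled differences. Only the product [al * be] has to be positive, so both scales may be
    negative; the symmetry of the binormal law rests on this. *)
Lemma integral_normal_pdf3 (R : realType) (s1 s2 s3 al be u v : R) :
  0 < s1 -> 0 < s2 -> 0 < s3 -> 0 < al * be ->
  al ^+ 2 = s1 ^+ 2 + s2 ^+ 2 -> be ^+ 2 = s1 ^+ 2 + s3 ^+ 2 ->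
  (\int[lebesgue_measure]_x
    (`|al| * normal_pdf 0 s2 (al * u + x) * (`|be| * normal_pdf 0 s3 (be * v + x)) *
     normal_pdf 0 s1 x)%:E =
   (binormal_pdf (s1 ^+ 2 / (al * be)) u v)%:E)%E.
Proof.
move=> s1_gt0 s2_gt0 s3_gt0 albe al2 be2.
(* [D2] occurs twice: the sum of the three inverse variances is [D2 / (s1 * s2 * s3) ^+ 2], which
   fixes the width in [x], and [(al * be) ^+ 2 - s1 ^+ 4 = D2], which gives [1 - rho ^+ 2]. *)
pose D2 := (s2 * s3) ^+ 2 + (s1 * s3) ^+ 2 + (s1 * s2) ^+ 2.
pose D := Num.sqrt D2.
have D2_gt0 : 0 < D2 by rewrite !addr_gt0 ?exprn_gt0 ?mulr_gt0.
have D0 : 0 < D by rewrite sqrtr_gt0.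
have DD : D ^+ 2 = D2 by rewrite sqr_sqrtr// ltW.
have [s1n s2n s3n] : [/\ s1 != 0, s2 != 0 & s3 != 0] by rewrite !gt_eqF.
have /andP[aln ben] : (al != 0) && (be != 0).
  by rewrite -negb_or -mulf_eq0 gt_eqF.
have Dn : D != 0 by rewrite gt_eqF.
have r0 := sqrt2pi_neq0 R.
have r2 : Num.sqrt (pi *+ 2) ^+ 2 = pi *+ 2 :> R.
  by rewrite sqr_sqrtr// mulrn_wge0// pi_ge0.
have rhoE : 1 - (s1 ^+ 2 / (al * be)) ^+ 2 = (D / (al * be)) ^+ 2.
  rewrite !exprMn DD exprVn exprMn al2 be2 /D2; field.
  by rewrite -?al2 -?be2 ?sqrf_eq0 ?aln ?ben.
rewrite /binormal_pdf rhoE sqrtr_sqr (gtr0_norm (divr_gt0 D0 albe)).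
rewrite !normal_pdfE// !normal_peakE// /normal_fun.
set r := Num.sqrt (pi *+ 2) in r0 r2 *.
transitivity (\int[lebesgue_measure]_x
  ((al * be / (s1 * s2 * s3 * r ^+ 3))%:E *
   (expR (- (x ^+ 2 / ((s1 * s2 * s3 / D) ^+ 2 *+ 2) +
     (al * u / s2 ^+ 2 + be * v / s3 ^+ 2) * x +
     (al ^+ 2 * u ^+ 2 / (s2 ^+ 2 *+ 2) + be ^+ 2 * v ^+ 2 / (s3 ^+ 2 *+ 2)))))%:E))%E.
  apply: eq_integral => x _; rewrite -EFinM; congr EFin.
  rewrite -(gtr0_norm albe) normrM.
  rewrite [LHS](_ : _ = `|al| * `|be| / (s1 * s2 * s3 * r ^+ 3) *
    (expR (- (al * u + x - 0) ^+ 2 / (s2 ^+ 2 *+ 2)) *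
     expR (- (be * v + x - 0) ^+ 2 / (s3 ^+ 2 *+ 2)) *
     expR (- (x - 0) ^+ 2 / (s1 ^+ 2 *+ 2)))); last by field; rewrite ?r0 ?s1n ?s2n ?s3n.
  rewrite -!expRD; congr (_ * expR _).
  rewrite !exprMn exprVn DD /D2; field.
  by rewrite s1n s2n s3n -/D2 gt_eqF.
rewrite ge0_integralZl_EFin//=.
- rewrite integral_expR_quadratic ?divr_gt0 ?mulr_gt0// -EFinM mulrA -/r -r2.
  congr (_ * expR _)%:E; first by field; rewrite ?r0 ?s1n ?s2n ?s3n ?Dn ?aln ?ben.
  (* Eliminating [s2] and [s3] turns the equality of exponents into a rational identity in [al],
     [be], [s1], [u], [v]. *)
  have s2E : s2 ^+ 2 = al ^+ 2 - s1 ^+ 2 by rewrite al2 addrC addKr.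
  have s3E : s3 ^+ 2 = be ^+ 2 - s1 ^+ 2 by rewrite be2 addrC addKr.
  have s2En : al ^+ 2 - s1 ^+ 2 != 0 by rewrite -s2E sqrf_eq0.
  have s3En : be ^+ 2 - s1 ^+ 2 != 0 by rewrite -s3E sqrf_eq0.
  have D2n : D2 != 0 by rewrite gt_eqF.
  rewrite !exprMn !exprVn !exprMn DD.
  move: D2n; rewrite /D2 !exprMn s2E s3E => D2n.
  by field; rewrite ?aln ?ben ?s1n ?s2En ?s3En ?D2n.
- apply/measurable_EFinP/measurableT_comp => //; apply: measurableT_comp => //.
  by apply: measurable_funD => //; apply: measurable_funD;
    apply: measurable_funM => //; exact: measurable_funX.
- by rewrite divr_ge0 ?(ltW albe)// mulr_ge0 ?exprn_ge0 ?sqrtr_ge0//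
    mulr_ge0 ?mulr_ge0// ltW.
Qed.

(** Passing to densities and to the sum [z] as a variable, Tonelli lets [x] be integrated first; the
    inner integral is then the convolution of the two densities. *)
Lemma normal_prob_convolution (R : realType) (a b : R) (C : set R) :
  0 < a -> 0 < b -> measurable C ->
  ((normal_prob 0 a \x normal_prob 0 b) [set z | C (z.1 + z.2)%R] =
   normal_prob 0 (Num.sqrt (a ^+ 2 + b ^+ 2)) C)%E.
Proof.
move=> a0 b0 mC.
have mpdf s : measurable_fun [set: R] (normal_pdf 0 s).
  exact: measurable_normal_pdf.
have mI : measurable_fun [set: R] (\1_C : R -> R) by exact: measurable_indic.
pose F (p : R * R) := (\1_C p.2 * normal_pdf 0 b (p.2 - p.1) * normal_pdf 0 a p.1)%:E.
have m1 : measurable_fun [set: R * R] (fun p => \1_C p.2 : R).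
  exact: measurableT_comp.
have mb : measurable_fun [set: R * R] (fun p => normal_pdf 0 b (p.2 - p.1)).
  by apply: measurableT_comp => //; exact: measurable_funB.
have ma : measurable_fun [set: R * R] (fun p => normal_pdf 0 a p.1).
  exact: measurableT_comp.
have mF : measurable_fun setT F.
  by apply/measurable_EFinP; apply: measurable_funM => //; exact: measurable_funM.
have F0 p : (0 <= F p)%E by rewrite lee_fin !mulr_ge0// normal_pdf_ge0.
have mbz x : measurable_fun [set: R] (fun z => normal_pdf 0 b (z - x)).
  by apply: measurableT_comp => //; exact: measurable_funB.
have mbx z : measurable_fun [set: R] (fun x => normal_pdf 0 b (z - x)).
  by apply: measurableT_comp => //; exact: measurable_funB.
transitivity (\int[normal_prob 0 a]_x
    \int[lebesgue_measure]_z (\1_C z * normal_pdf 0 b (z - x))%:E)%E.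
  apply: eq_integral => x _ /=.
  have mCx : measurable [set y | C (x + y)].
    rewrite -[X in measurable X]setTI.
    exact: (measurable_funD (measurable_cst x) (@measurable_id _ _ _)).
  rewrite (_ : xsection _ _ = [set y | C (x + y)]); last first.
    by apply/seteqP; split => y; rewrite /xsection /= inE.
  rewrite normal_probE//.
  (* Substitution [y = z - x], where [z] is the value of the sum. *)
  rewrite (@ge0_integral_affine _ 1 (- x)) ?oner_eq0// ?normr1 ?mul1e.
  - apply: eq_integral => z _; rewrite -EFinM mul1r !indicE.
    congr (_ * _)%:E; congr (_%:R); congr nat_of_bool.
    by apply/idP/idP; rewrite !inE/= addrC subrK.
  - apply: emeasurable_funM; apply/measurable_EFinP;
      [exact: measurable_indic|exact: mpdf].
  - by move=> y; rewrite mule_ge0// lee_fin ?normal_pdf_ge0.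
rewrite ge0_integral_normal_prob.
- transitivity (\int[lebesgue_measure]_x \int[lebesgue_measure]_z F (x, z))%E.
    apply: eq_integral => x _; rewrite -ge0_integralZr//=.
    + by apply/measurable_EFinP; exact: measurable_funM mI (mbz x).
    + by move=> z _; rewrite lee_fin mulr_ge0// normal_pdf_ge0.
    + by rewrite lee_fin normal_pdf_ge0.
  etransitivity.
    exact: (@fubini_tonelli _ _ _ _ _ lebesgue_measure lebesgue_measure F).
  rewrite normal_probE//.
  apply: eq_integral => z _; rewrite -integral_normal_pdfM// -ge0_integralZl//=.
  + by apply: eq_integral => x _; rewrite -EFinM mulrA.
  + by apply/measurable_EFinP; exact: measurable_funM (mbx z) (mpdf a).
  + by move=> x _; rewrite lee_fin mulr_ge0// normal_pdf_ge0.
- have := @measurable_fun_fubini_tonelli_F _ _ _ _ _ lebesgue_measure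
    (fun p : R * R => (\1_C p.2 * normal_pdf 0 b (p.2 - p.1))%:E).
  apply; last by move=> p; rewrite lee_fin mulr_ge0// normal_pdf_ge0.
  by apply/measurable_EFinP; exact: measurable_funM.
- by move=> x; apply: integral_ge0 => z _; rewrite lee_fin mulr_ge0// normal_pdf_ge0.
Qed.

(** Here [x] is a frozen value of the variable common to both pairs. The substitutions [be * v + x]
    and [al * u + x] are made one coordinate at a time, the second coordinate first. *)
Lemma normal_prob_product_affine (R : realType) (s2 s3 al be x : R)
    (C : set (R * R)) : al != 0 -> be != 0 -> measurable C ->
  ((normal_prob 0 s2 \x normal_prob 0 s3)
     [set y | C ((y.1 - x) / al, (y.2 - x) / be)%R] =
   \int[lebesgue_measure \x lebesgue_measure]_z
     (\1_C z * (`|al| * normal_pdf 0 s2 (al * z.1 + x) *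
                (`|be| * normal_pdf 0 s3 (be * z.2 + x))))%:E)%E.
Proof.
move=> al0 be0 mC.
have mpdf s : measurable_fun [set: R] (normal_pdf 0 s).
  exact: measurable_normal_pdf.
have mI : measurable_fun [set: R * R] (\1_C : R * R -> R).
  exact: measurable_indic.
have maff s (c : R) : measurable_fun [set: R]
    (fun u => `|c| * normal_pdf 0 s (c * u + x)).
  apply: measurable_funM => //; apply: measurableT_comp => //.
  by apply: measurable_funD => //; exact: measurable_funM.
have ma (c : R) : measurable_fun [set: R] (fun u => c * u + x).
  by apply: measurable_funD => //; exact: measurable_funM.
have aff0 s c u : 0 <= `|c| * normal_pdf 0 s (c * u + x).
  by rewrite mulr_ge0// normal_pdf_ge0.
pose H (z : R * R) := (\1_C z * (`|be| * normal_pdf 0 s3 (be * z.2 + x)))%:E.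
have mH : measurable_fun setT H.
  apply/measurable_EFinP; apply: measurable_funM => //.
  exact: (measurableT_comp (maff s3 be) measurable_snd).
have H0 z : (0 <= H z)%E by rewrite lee_fin mulr_ge0.
(* [G] is what remains of the inner integral once the substitution in the second coordinate is
   done. *)
pose G u : \bar R := (\int[lebesgue_measure]_v H (u, v))%E.
have mG : measurable_fun [set: R] G.
  exact: (@measurable_fun_fubini_tonelli_F _ _ _ _ _ lebesgue_measure H).
have G0 u : (0 <= G u)%E by apply: integral_ge0.
have mdiv c : measurable_fun [set: R] (fun y => (y - x) / c).
  by apply: measurable_funM => //; exact: measurable_funB.
have mD : measurable_fun [set: R * R]
    (fun y : R * R => ((y.1 - x) / al, (y.2 - x) / be)).
  apply: measurable_fun_pair.
    exact: (measurableT_comp (mdiv al) measurable_fst).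
  exact: (measurableT_comp (mdiv be) measurable_snd).
transitivity (\int[normal_prob 0 s2]_y G ((y - x) / al)%R)%E.
  apply: eq_integral => y _ /=.
  have my : measurable_fun [set: R]
      (fun z : R => ((y - x) / al, (z - x) / be)).
    exact: measurable_fun_pair.
  rewrite (_ : xsection _ _ = [set z | C ((y - x) / al, (z - x) / be)]); last first.
    by apply/seteqP; split => z; rewrite /xsection /= inE.
  have mCy : measurable [set z | C ((y - x) / al, (z - x) / be)].
    by rewrite -[X in measurable X]setTI; exact: my.
  rewrite normal_probE// (@ge0_integral_affine _ be x)//.
  - rewrite /G -ge0_integralZl//=.
    + apply: eq_integral => v _; rewrite /H -!EFinM mulrCA; congr (_ * _)%:E.
      congr (_%:R); congr nat_of_bool.
      by apply/idP/idP; rewrite !inE/= addrK mulrAC divff// mul1r.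
    + apply: emeasurable_funM; apply/measurable_EFinP.
        exact: measurableT_comp (measurable_indic mCy) (ma be).
      exact: measurableT_comp (mpdf s3) (ma be).
    + by move=> v _; rewrite lee_fin mulr_ge0// normal_pdf_ge0.
  - apply: emeasurable_funM; apply/measurable_EFinP;
      [exact: measurable_indic|exact: mpdf].
  - by move=> z; rewrite mule_ge0// lee_fin ?normal_pdf_ge0.
rewrite ge0_integral_normal_prob.
- rewrite (@ge0_integral_affine _ al x)//.
  + rewrite -ge0_integralZl//=.
    * etransitivity; last first.
        apply/esym; apply: (@fubini_tonelli1 _ _ _ _ _ lebesgue_measure lebesgue_measure
          (fun z => (\1_C z * (`|al| * normal_pdf 0 s2 (al * z.1 + x) *
                (`|be| * normal_pdf 0 s3 (be * z.2 + x))))%:E)).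
          apply/measurable_EFinP/measurable_funM; first exact: mI.
          apply: measurable_funM.
            exact: (measurableT_comp (maff s2 al) measurable_fst).
          exact: (measurableT_comp (maff s3 be) measurable_snd).
        by move=> z; rewrite lee_fin !mulr_ge0// normal_pdf_ge0.
      apply: eq_integral => u _; rewrite /fubini_F /=.
      rewrite addrK mulrAC divff// mul1r muleCA -EFinM /G -ge0_integralZr//=.
      { by apply: eq_integral => v _; rewrite /H -EFinM; congr EFin; ring. }
      { exact: measurableT_comp mH
          (measurable_fun_pair (measurable_cst u) (@measurable_id _ _ _)). }
      { by rewrite lee_fin. }
    * apply: emeasurable_funM.
        exact: measurableT_comp (measurableT_comp mG (mdiv al)) (ma al).
      apply/measurable_EFinP; exact: measurableT_comp (mpdf s2) (ma al).
    * by move=> u _; rewrite mule_ge0// lee_fin normal_pdf_ge0.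
  + apply: emeasurable_funM; first exact: measurableT_comp mG (mdiv al).
    apply/measurable_EFinP; exact: mpdf.
  + by move=> u; rewrite mule_ge0// lee_fin normal_pdf_ge0.
- by apply: measurableT_comp => //; exact: mG.
- by move=> y; exact: G0.
Qed.

(* Canonical inference finds the sigma-finite structure of a product measure only
   for subprobabilities. *)
Lemma sigma_finite_product_measure (d1 d2 : measure_display)
    (T1 : measurableType d1) (T2 : measurableType d2) (R : realType)
    (m1 : {sigma_finite_measure set T1 -> \bar R})
    (m2 : {sigma_finite_measure set T2 -> \bar R}) :
  sigma_finite setT (m1 \x m2)%E.
Proof.
have /sigma_finiteP[F [TF ndF Foo]] := sigma_finiteT m1.
have /sigma_finiteP[G [TG ndG Goo]] := sigma_finiteT m2.
exists (fun n => F n `*` G n).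
  apply/esym; rewrite -subTset => -[x y] _.
  have [n _ Fnx] : (\bigcup_n F n) x by rewrite -TF.
  have [k _ Gky] : (\bigcup_n G n) y by rewrite -TG.
  exists (maxn n k) => //; split.
  - by move: x Fnx; exact/subsetPset/ndF/leq_maxl.
  - by move: y Gky; exact/subsetPset/ndG/leq_maxr.
move=> k; have [mF Fk] := Foo k; have [mG Gk] := Goo k.
split; first exact: measurableX.
by rewrite product_measure1E// lte_mul_pinfty// ge0_fin_numE.
Qed.

(** The sections at a fixed first variable [x] have an explicit density in the scaled differences;
    Tonelli moves the integral over [x] inside, where [integral_normal_pdf3] evaluates it. *)
Lemma normal_prob_product_binormal (R : realType) (s1 s2 s3 al be : R)
    (C : set (R * R)) :
  0 < s1 -> 0 < s2 -> 0 < s3 -> 0 < al * be ->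
  al ^+ 2 = s1 ^+ 2 + s2 ^+ 2 -> be ^+ 2 = s1 ^+ 2 + s3 ^+ 2 -> measurable C ->
  ((normal_prob 0 s1 \x (normal_prob 0 s2 \x normal_prob 0 s3))
     [set x | C ((x.2.1 - x.1) / al, (x.2.2 - x.1) / be)%R] =
   binormal_prob (s1 ^+ 2 / (al * be)) C)%E.
Proof.
move=> s1_gt0 s2_gt0 s3_gt0 albe al2 be2 mC.
have /andP[aln ben] : (al != 0) && (be != 0).
  by rewrite -negb_or -mulf_eq0 gt_eqF.
have mpdf s : measurable_fun [set: R] (normal_pdf 0 s).
  exact: measurable_normal_pdf.
have mI : measurable_fun [set: R * R] (\1_C : R * R -> R).
  exact: measurable_indic.
pose L x u v := `|al| * normal_pdf 0 s2 (al * u + x) *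
  (`|be| * normal_pdf 0 s3 (be * v + x)).
have L0 x u v : 0 <= L x u v by rewrite !mulr_ge0// normal_pdf_ge0.
have mL : measurable_fun [set: R * (R * R)]
    (fun p : R * (R * R) => L p.1 p.2.1 p.2.2).
  have m21 : measurable_fun [set: R * (R * R)] (fun p : R * (R * R) => p.2.1).
    exact: measurableT_comp measurable_fst measurable_snd.
  have m22 : measurable_fun [set: R * (R * R)] (fun p : R * (R * R) => p.2.2).
    exact: measurableT_comp measurable_snd measurable_snd.
  apply: measurable_funM; apply: measurable_funM => //;
    apply: measurableT_comp => //; apply: measurable_funD => //;
    exact: measurable_funM.
pose K (p : R * (R * R)) := (\1_C p.2 * L p.1 p.2.1 p.2.2)%:E.
have mCL : measurable_fun [set: R * (R * R)]
    (fun p => \1_C p.2 * L p.1 p.2.1 p.2.2).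
  by apply: measurable_funM => //; exact: measurableT_comp.
have mK : measurable_fun setT K by apply/measurable_EFinP.
have K0 p : (0 <= K p)%E by rewrite lee_fin mulr_ge0.
pose F (p : R * (R * R)) := (\1_C p.2 * L p.1 p.2.1 p.2.2 * normal_pdf 0 s1 p.1)%:E.
have mF : measurable_fun setT F.
  by apply/measurable_EFinP/measurable_funM => //; exact: measurableT_comp.
have F0 p : (0 <= F p)%E by rewrite lee_fin !mulr_ge0// normal_pdf_ge0.
pose lebR : {sigma_finite_measure set (measurableTypeR R) -> \bar R} :=
  @lebesgue_measure R.
(* Tonelli is applied between the line and the plane, so the planar measure must carry its
   sigma-finite structure. *)
pose leb2 : {sigma_finite_measure set _ -> \bar R} := HB.pack (lebR \x lebR)%E
  (Measure_isSigmaFinite.Build _ _ _ (lebR \x lebR)%E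
    (sigma_finite_product_measure lebR lebR)).
transitivity (\int[normal_prob 0 s1]_x \int[leb2]_z K (x, z))%E.
  apply: eq_integral => x _ /=; rewrite -normal_prob_product_affine//.
  congr (product_measure1 _ _ _).
  by apply/seteqP; split => y; rewrite /xsection /= inE.
rewrite ge0_integral_normal_prob.
- transitivity (\int[lebesgue_measure]_x \int[leb2]_z F (x, z))%E.
    apply: eq_integral => x _; rewrite -ge0_integralZr//=.
    + exact: measurableT_comp mK
        (measurable_fun_pair (measurable_cst x) (@measurable_id _ _ _)).
    + by rewrite lee_fin normal_pdf_ge0.
  etransitivity; first exact: (@fubini_tonelli _ _ _ _ _ lebesgue_measure leb2 F).
  rewrite /binormal_prob [RHS]integral_mkcond epatch_indic.
  apply: eq_integral => z _.
  rewrite -(integral_normal_pdf3 _ _ s1_gt0 s2_gt0 s3_gt0 albe)//.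
  rewrite -ge0_integralZr//=.
  + by apply: eq_integral => x _; rewrite -EFinM; congr EFin; rewrite /L; ring.
  + apply/measurable_EFinP/measurable_funM; last exact: mpdf.
    exact: measurableT_comp mL
      (measurable_fun_pair (@measurable_id _ _ _) (measurable_cst z)).
  + by move=> x _; rewrite lee_fin !mulr_ge0// normal_pdf_ge0.
- exact: (@measurable_fun_fubini_tonelli_F _ _ _ _ _ leb2 K).
- by move=> x; apply: integral_ge0.
Qed.

(** * Independence *)

(** The moment generating function of a centred normal law, source of all the log-normal moments. *)
Lemma integral_normal_prob_expR (R : realType) (s l : R) : 0 < s ->
  (\int[normal_prob 0 s]_x (expR (l * x))%:E =
   (expR (l ^+ 2 * s ^+ 2 / 2))%:E)%E.
Proof.
move=> s0; have s_neq0 : s != 0 by rewrite gt_eqF.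
have mexp : measurable_fun [set: R] (fun x => expR (l * x)).
  by apply: measurableT_comp => //; exact: measurable_funM.
rewrite ge0_integral_normal_prob//; last by apply/measurable_EFinP.
rewrite normal_pdfE// normal_peakE// /normal_fun.
transitivity (\int[lebesgue_measure]_x (((s * Num.sqrt (pi *+ 2))^-1)%:E *
  (expR (- (x ^+ 2 / (s ^+ 2 *+ 2) + (- l) * x + 0)))%:E))%E.
  apply: eq_integral => x _; rewrite -!EFinM; congr EFin.
  by rewrite mulrCA -expRD; congr (_ * expR _); field.
rewrite ge0_integralZl_EFin//=.
- rewrite integral_expR_quadratic// -EFinM mulrA mulVf ?mul1r.
    by congr (expR _)%:E; ring.
  by rewrite mulf_neq0// sqrt2pi_neq0.
- apply/measurable_EFinP/measurableT_comp => //; apply: measurableT_comp => //.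
  by apply: measurable_funD => //; apply: measurable_funD;
    apply: measurable_funM => //; exact: measurable_funX.
- by rewrite invr_ge0 mulr_ge0 ?sqrtr_ge0// ltW.
Qed.

(** * Independence of an event and two variables: from rectangles to integrals *)

Section event_independent_pair.
Context d d1 d2 (T : measurableType d) (T1 : measurableType d1)
  (T2 : measurableType d2) (R : realType) (P : probability T R).
Variables (E : set T) (Y : T -> T1) (Z : T -> T2).
Variables (m1 : probability T1 R) (m2 : probability T2 R).
Hypotheses (mE : measurable E) (mY : measurable_fun setT Y)
  (mZ : measurable_fun setT Z).
Hypothesis rectE : forall A B, measurable A -> measurable B ->
  P (E `&` (Y @^-1` A `&` Z @^-1` B)) = (P E * (m1 A * m2 B))%E.

Let mYZ : measurable_fun setT (fun w => (Y w, Z w)).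
Proof. exact: measurable_fun_pair. Qed.

Let p := NngNum (fine_ge0 (measure_ge0 P E)).

Let pE : p%:num%:E = P E.
Proof. by rewrite /= fineK// fin_num_measure. Qed.

(** Restricting [P] to [E] and pushing forward by [(Y, Z)] gives a measure known on rectangles.
    Uniqueness of the product measure applies once the mass [P E] is put into the first factor as
    the scalar [p]. *)
Lemma probability_setI_pair D : measurable D ->
  P (E `&` [set w | D (Y w, Z w)]) = (P E * (m1 \x m2) D)%E.
Proof.
move=> mD.
have rect A B : measurable A -> measurable B ->
    pushforward_measure (mrestr P mE) mYZ (A `*` B) = (mscale p m1 A * m2 B)%E.
  move=> mA mB; rewrite /= /pushforward /mrestr /mscale pE -muleA -rectE//.
  by rewrite setIC; congr (P (_ `&` _)).
have := product_measure_unique rect mD.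
rewrite /product_measure1 ge0_integral_mscale//; last first.
  exact: measurable_fun_xsection.
by rewrite pE => ->; rewrite /= /pushforward /mrestr setIC.
Qed.

(** The integral over [E] is an integral against [P] restricted to [E], for which the complement of
    [E] is negligible; its image under [(Y, Z)] is the scaled product measure. *)
Lemma integral_setI_pair (f : T1 * T2 -> \bar R) : measurable_fun setT f ->
  (forall z, 0 <= f z)%E ->
  (\int[P]_(w in E) f (Y w, Z w) = P E * \int[m1 \x m2]_z f z)%E.
Proof.
move=> mf f0.
transitivity (\int[pushforward_measure (mrestr P mE) mYZ]_z f z)%E.
  rewrite ge0_integral_pushforward// preimage_setT.
  rewrite (ge0_negligible_integral (measurableC mE))//=.
  - rewrite setTD setCK; apply: eq_measure_integral => A mA AE.
    by rewrite /= /mrestr setIidl.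
  - exact: measurableT_comp.
  - by rewrite /mrestr setICl measure0.
rewrite (eq_measure_integral (mscale p (m1 \x m2)%E)) => [|D mD _].
  by rewrite ge0_integral_mscale// pE.
rewrite [RHS](_ : _ = P E * (m1 \x m2) D)%E; last by rewrite -pE.
by rewrite -probability_setI_pair// setIC.
Qed.

Lemma integral_setI_pairM (g : T1 -> \bar R) (h : T2 -> \bar R) :
  measurable_fun setT g -> measurable_fun setT h ->
  (forall y, 0 <= g y)%E -> (forall z, 0 <= h z)%E ->
  (\int[P]_(w in E) (g (Y w) * h (Z w)) =
   P E * (\int[m1]_y g y * \int[m2]_z h z))%E.
Proof.
move=> mg mh g0 h0.
have mgh : measurable_fun setT (fun z : T1 * T2 => g z.1 * h z.2)%E.
  by apply: emeasurable_funM; apply: measurableT_comp.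
have gh0 (z : T1 * T2) : (0 <= g z.1 * h z.2)%E by exact: mule_ge0.
rewrite (integral_setI_pair mgh gh0) fubini_tonelli1//; congr (_ * _)%E.
rewrite -ge0_integralZr//=; last exact: integral_ge0.
by apply: eq_integral => y _; rewrite /fubini_F/= ge0_integralZl.
Qed.

End event_independent_pair.

(** * Mutually independent families: joint laws and grouping *)

Section mutual_independence.
Context d (T : measurableType d) (R : realType) (P : probability T R).
Variables (I : eqType) (ok : I -> Prop) (X : I -> T -> R).
Hypothesis mX : forall l, ok l -> measurable_fun setT (X l).
Hypothesis indX : mutually_independent P ok X.

Definition joint_event (J : seq I) (B : I -> set R) :=
  [set w | forall l, l \in J -> B l (X l w)].

Lemma joint_event_cons i J B :
  joint_event (i :: J) B = X i @^-1` B i `&` joint_event J B.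
Proof.
apply/seteqP; split => w /=.
  by move=> JB; split => [|l lJ]; apply: JB; rewrite inE ?eqxx// lJ orbT.
by move=> [Bi JB] l; rewrite inE => /predU1P[->//|/JB].
Qed.

Lemma eq_joint_event J B B' : {in J, B =1 B'} ->
  joint_event J B = joint_event J B'.
Proof.
by move=> BB'; apply/seteqP; split => w /= JB l lJ;
  [rewrite -BB'//|rewrite BB'//]; exact: JB.
Qed.

Lemma measurable_joint_event J B :
  (forall l, l \in J -> ok l /\ measurable (B l)) -> measurable (joint_event J B).
Proof.
elim: J => [_|i J IH okB].
  by rewrite (_ : joint_event _ _ = setT)//; apply/seteqP; split.
rewrite joint_event_cons; apply: measurableI.
  have [oki mBi] := okB i (mem_head _ _).
  by rewrite -[X in measurable X]setTI; exact: mX.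
by apply: IH => l lJ; apply: okB; rewrite inE lJ orbT.
Qed.

Lemma probability_joint_event_cons i J B : i \notin J -> uniq J ->
  (forall l, l \in i :: J -> ok l /\ measurable (B l)) ->
  P (joint_event (i :: J) B) = (P (X i @^-1` B i) * P (joint_event J B))%E.
Proof.
move=> iJ uJ okB; rewrite /joint_event !indX//= ?iJ// ?big_cons//.
by move=> l lJ; apply: okB; rewrite inE lJ orbT.
Qed.

(** Since [i] is not in [J], the family [B] may be redefined at [i] to be [A], which makes the
    intersection a single joint event. The lemmas below use the same device. *)
Lemma probability_joint_event_setI i J B A : i \notin J -> uniq J -> ok i ->
  measurable A -> (forall l, l \in J -> ok l /\ measurable (B l)) ->
  P (X i @^-1` A `&` joint_event J B) = (P (X i @^-1` A) * P (joint_event J B))%E.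
Proof.
move=> iJ uJ oki mA okB.
pose B' l := if l == i then A else B l.
have B'i : B' i = A by rewrite /B' eqxx.
have B'J : {in J, B =1 B'}.
  by move=> l lJ; rewrite /B'; case: eqP => // li; rewrite -li lJ in iJ.
rewrite (eq_joint_event B'J) -B'i -joint_event_cons probability_joint_event_cons//.
move=> l; rewrite inE => /predU1P[->|lJ]; first by rewrite B'i.
by rewrite -B'J//; exact: okB.
Qed.

Lemma probability_joint_event_pair i j
    (m1 m2 : probability (measurableTypeR R) R) J B D :
  i != j -> i \notin J -> j \notin J -> uniq J -> ok i -> ok j ->
  (forall A, measurable A -> P (X i @^-1` A) = m1 A) ->
  (forall A, measurable A -> P (X j @^-1` A) = m2 A) ->
  (forall l, l \in J -> ok l /\ measurable (B l)) -> measurable D ->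
  P (joint_event J B `&` [set w | D (X i w, X j w)]) =
  (P (joint_event J B) * (m1 \x m2) D)%E.
Proof.
move=> ij iJ jJ uJ oki okj m1E m2E okB mD.
apply: probability_setI_pair => //.
- exact: measurable_joint_event.
- exact: mX.
- exact: mX.
move=> A C mA mC; rewrite -m1E// -m2E//.
pose B' l := if l == j then C else B l.
have B'J : {in J, B =1 B'}.
  by move=> l lJ; rewrite /B'; case: eqP => // lj; rewrite -lj lJ in jJ.
have -> : joint_event J B `&` (X i @^-1` A `&` X j @^-1` C) =
    X i @^-1` A `&` joint_event (j :: J) B'.
  by rewrite joint_event_cons -(eq_joint_event B'J) {1}/B' eqxx setIC setIA.
have okB' l : l \in j :: J -> ok l /\ measurable (B' l).
  rewrite inE => /predU1P[->|lJ]; first by rewrite /B' eqxx.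
  by rewrite -B'J//; exact: okB.
rewrite probability_joint_event_setI//=.
- rewrite probability_joint_event_cons// -(eq_joint_event B'J) {1}/B' eqxx.
  by rewrite muleA muleC.
- by rewrite inE negb_or ij.
- by rewrite jJ.
Qed.

(** The pair of [X j] and [X k] is treated as one variable of law [m2 \x m3]; on rectangles the
    condition on [X i] joins the event, and the statement for pairs applies. *)
Lemma probability_joint_event_triple i j k
    (m1 m2 m3 : probability (measurableTypeR R) R) J B D :
  uniq [:: i, j, k & J] -> ok i -> ok j -> ok k ->
  (forall A, measurable A -> P (X i @^-1` A) = m1 A) ->
  (forall A, measurable A -> P (X j @^-1` A) = m2 A) ->
  (forall A, measurable A -> P (X k @^-1` A) = m3 A) ->
  (forall l, l \in J -> ok l /\ measurable (B l)) -> measurable D ->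
  P (joint_event J B `&` [set w | D (X i w, (X j w, X k w))]) =
  (P (joint_event J B) * (m1 \x (m2 \x m3)) D)%E.
Proof.
move=> /= /and4P[+ + kJ uJ] oki okj okk m1E m2E m3E okB mD.
rewrite !inE !negb_or => /and3P[ij ik iJ] /andP[jk jJ].
pose m23 : probability (measurableTypeR R * measurableTypeR R)%type R :=
  (m2 \x m3)%E.
rewrite -[RHS]/(P (joint_event J B) * (m1 \x m23) D)%E.
apply: (@probability_setI_pair _ _ _ _ (measurableTypeR R)
  (measurableTypeR R * measurableTypeR R)%type _ _ _ (X i)
  (fun w => (X j w, X k w)) m1 m23) => //.
- exact: measurable_joint_event.
- exact: mX.
- by apply: measurable_fun_pair; exact: mX.
move=> A C mA mC.
pose B' l := if l == i then A else B l.
have B'J : {in J, B =1 B'}.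
  by move=> l lJ; rewrite /B'; case: eqP => // li; rewrite -li lJ in iJ.
have okB' l : l \in i :: J -> ok l /\ measurable (B' l).
  rewrite inE => /predU1P[->|lJ]; first by rewrite /B' eqxx.
  by rewrite -B'J//; exact: okB.
have -> : joint_event J B `&` (X i @^-1` A `&` (fun w => (X j w, X k w)) @^-1` C) =
    joint_event (i :: J) B' `&` [set w | C (X j w, X k w)].
  rewrite joint_event_cons -(eq_joint_event B'J) {1}/B' eqxx setIA.
  by rewrite [in RHS](setIC (_ @^-1` _)).
rewrite (probability_joint_event_pair (m1 := m2) (m2 := m3))//=.
- rewrite probability_joint_event_cons// -(eq_joint_event B'J) {1}/B' eqxx.
  by rewrite m1E// -muleA muleCA.
- by rewrite inE negb_or eq_sym ij.
- by rewrite inE negb_or eq_sym ik.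
- by rewrite iJ.
Qed.

(** Grouping two members of the family into one keeps independence, provided that the index [j] is
    retired. This is what lets increments be summed one by one. *)
Lemma mutually_independent_merge i j (f : R * R -> R) :
  i != j -> ok i -> ok j -> measurable_fun setT f ->
  mutually_independent P (fun l => ok l /\ l != j)
    (fun l => if l == i then fun w => f (X i w, X j w) else X l).
Proof.
move=> ij oki okj mf J B uJ okB.
pose X' l := if l == i then fun w => f (X i w, X j w) else X l.
rewrite -[LHS]/(P [set w | forall l, l \in J -> B l (X' l w)]).
rewrite -[RHS]/(\prod_(l <- J) P (X' l @^-1` B l))%E.
have XX' l : l != i -> X' l = X l by rewrite /X' => /negbTE ->.
have [iJ|iJ] := boolP (i \in J); last first.
  have Ji l : l \in J -> l != i by apply: contraTneq => ->.
  have -> : [set w | forall l, l \in J -> B l (X' l w)] = joint_event J B.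
    by apply/seteqP; split => w /= JB l lJ; have := JB l lJ; rewrite XX'// Ji.
  rewrite /joint_event indX//; last by move=> l /okB[[]].
  by rewrite big_seq [RHS]big_seq; apply: eq_bigr => l lJ; rewrite XX'// Ji.
have mX' l : ok l -> measurable_fun setT (X l : T -> measurableTypeR R).
  exact: mX.
(* The statement for pairs asks for the two laws as probability measures; nothing is assumed on them
   here, so the distributions themselves are taken. *)
pose law l (okl : ok l) : probability (measurableTypeR R) R :=
  distribution P (HB.pack (X l : T -> measurableTypeR R)
    (isMeasurableFun.Build _ _ _ _ _ (mX' l okl)) : {mfun T >-> measurableTypeR R}).
pose J' := rem i J.
have J'J l : l \in J' -> l \in J by exact: mem_rem.
have uJ' : uniq J' by exact: rem_uniq.
have iJ' : i \notin J' by rewrite mem_rem_uniqF.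
have jJ' : j \notin J' by apply/negP => /J'J /okB[[_]]; rewrite eqxx.
have J'i l : l \in J' -> l != i by apply: contraTneq => ->.
have okB' l : l \in J' -> ok l /\ measurable (B l).
  by move=> /J'J /okB[[]].
have [_ mBi] := okB i iJ.
pose D := [set z | B i (f z)].
have mD : measurable D by rewrite -[D]setTI; exact: mf.
have X'i : X' i @^-1` B i = [set w | D (X i w, X j w)].
  by rewrite /X' eqxx.
(* Used twice: with [J'] for the joint probability, and with the empty list to recognise the product
   measure of [D] as the law of the merged variable. *)
have pair J0 := @probability_joint_event_pair i j (law i oki) (law j okj) J0 B D ij.
have -> : [set w | forall l, l \in J -> B l (X' l w)] =
    joint_event J' B `&` [set w | D (X i w, X j w)].
  rewrite -X'i; apply/seteqP; split => w /= => [JB|[JB Bi] l lJ].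
    split; last exact: JB.
    by move=> l lJ'; rewrite -(XX' l (J'i l lJ')); exact/JB/J'J.
  have [->//|li] := eqVneq l i.
  by rewrite XX'//; apply: JB; rewrite mem_rem_uniq// !inE li.
rewrite pair// (perm_big _ (perm_to_rem iJ)) big_cons muleC; congr (_ * _)%E.
  have := pair [::]; rewrite X'i.
  rewrite (_ : joint_event [::] B = setT); last by apply/seteqP; split.
  by rewrite setTI probability_setT mul1e => ->.
rewrite /joint_event indX// [LHS]big_seq [RHS]big_seq.
by apply: eq_bigr => l lJ'; rewrite XX'// J'i.
Qed.

End mutual_independence.

(** * Partial sums of the increments *)

Lemma sub_mutually_independent d (T : measurableType d) (R : realType)
    (P : probability T R) (I : eqType) (ok ok' : I -> Prop) (X : I -> T -> R) :
  (forall l, ok' l -> ok l) -> mutually_independent P ok X ->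
  mutually_independent P ok' X.
Proof.
by move=> ok'ok indX J B uJ okB; apply: indX => // l /okB[/ok'ok].
Qed.

Section partial_sums.
Context d (T : measurableType d) (R : realType) (P : probability T R) (n : nat).
Variables (delta : 'I_n -> nat -> T -> R).
Hypothesis mdelta : forall i s, measurable_fun setT (delta i s).
Hypothesis inddelta : mutually_independent P (fun j : 'I_n * nat => (0 < j.2)%N)
  (fun j => delta j.1 j.2).

(* The index (i, 1) carries the partial sum of the first tau i increments of
   walk i; the increments that have not yet been absorbed keep their index. *)
Definition absorbed (tau : 'I_n -> nat) (l : 'I_n * nat) : T -> R :=
  if l.2 == 1%N then fun w => \sum_(1 <= r < (tau l.1).+1) delta l.1 r w
  else delta l.1 l.2.

Definition unabsorbed (tau : 'I_n -> nat) (l : 'I_n * nat) : Prop :=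
  (l.2 == 1%N) || (tau l.1 < l.2)%N.

Lemma measurable_absorbed tau l : measurable_fun setT (absorbed tau l).
Proof.
rewrite /absorbed; case: ifP => // _; apply: measurable_sum => r.
exact: mdelta.
Qed.

(** A merge of the indices [(i, 1)] and [(i, (tau i).+1)] by addition; [0 < tau i] keeps these two
    indices distinct. *)
Lemma mutually_independent_absorb tau i : (0 < tau i)%N ->
  mutually_independent P (unabsorbed tau) (absorbed tau) ->
  let tau' := fun i' => (tau i' + (i' == i))%N in
  mutually_independent P (unabsorbed tau') (absorbed tau').
Proof.
move=> taui ind tau'.
have ij : (i, 1%N) != (i, (tau i).+1).
  by rewrite xpair_eqE eqxx/= eqSS neq_ltn taui.
pose X' l := if l == (i, 1%N)
  then fun w => absorbed tau (i, 1%N) w + absorbed tau (i, (tau i).+1) w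
  else absorbed tau l.
have -> : absorbed tau' = X'.
  apply/funext => -[i' s]; rewrite /X' /absorbed xpair_eqE /tau' /=.
  have [->|ii'] := eqVneq i' i => /=; last by rewrite addn0.
  have [_|//] := eqVneq s 1%N.
  apply/funext => w; rewrite addn1 big_nat_recr//=.
  by rewrite eqSS (gtn_eqF taui).
have := @mutually_independent_merge _ _ _ P _ _ _
  (fun l _ => measurable_absorbed tau l) ind _ _ (fun z : R * R => z.1 + z.2) ij.
move=> merge; apply: (sub_mutually_independent _ (merge _ _ _)).
- move=> [i' s]; rewrite /unabsorbed/= xpair_eqE /tau' => /orP[/eqP->|ts].
    by split=> //; rewrite eqSS negb_and (eq_sym 0%N) -lt0n taui orbT.
  split; first by rewrite (leq_ltn_trans (leq_addr _ _) ts) orbT.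
  apply/negP => /andP[/eqP ii' /eqP st].
  by move: ts; rewrite ii' eqxx addn1 st ltnn.
- by rewrite /unabsorbed.
- by rewrite /unabsorbed/= ltnSn orbT.
- exact: measurable_funD.
Qed.

(** Induction on [t]. For [t = 1] the sums are single increments, so the family is the original
    one. *)
Lemma mutually_independent_partial_sums t : (0 < t)%N ->
  mutually_independent P (unabsorbed (fun=> t)) (absorbed (fun=> t)).
Proof.
elim: t => // -[_ _|t IH _].
  have -> : absorbed (fun=> 1%N) = (fun j => delta j.1 j.2).
    apply/funext => -[i s]; rewrite /absorbed/=; case: eqP => // ->.
    by apply/funext => w; rewrite big_nat1.
  apply: sub_mutually_independent inddelta => -[i s]; rewrite /unabsorbed/=.
  by move=> /orP[/eqP->//|]; apply: ltn_trans.
(* One time step is made walk by walk: after [m] merges, the walks of index below [m] have absorbed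
   one increment more than the others. *)
have step m : (m <= n)%N -> mutually_independent P
    (unabsorbed (fun i => t.+1 + (i < m))%N) (absorbed (fun i => t.+1 + (i < m))%N).
  elim: m => [_|m IHm mn].
    rewrite (_ : (fun i => _) = (fun=> t.+1)); first exact: IH.
    by apply/funext => i; rewrite addn0.
  have := @mutually_independent_absorb _ (Ordinal mn) _ (IHm (ltnW mn)).
  rewrite /= (_ : (fun i' => _) = (fun i : 'I_n => t.+1 + (i < m.+1))%N); first exact.
  apply/funext => i; rewrite -addnA; congr (_ + _)%N.
  by rewrite -val_eqE/= ltnS [in RHS]leq_eqVlt; case: ltngtP.
have := step n (leqnn n).
rewrite (_ : (fun i => _) = (fun=> t.+2))//.
by apply/funext => i; rewrite ltn_ord addn1.
Qed.

(** Induction on [t]: in the absorbed family the sum, at index [(i, 1)], and the next increment are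
    independent, so their normal laws convolve and the variances add up. *)
Lemma normal_partial_sum (sigma : 'I_n -> R) i t : (0 < t)%N -> 0 < sigma i ->
  (forall s, (0 < s)%N -> forall A, measurable A ->
    P (delta i s @^-1` A) = normal_prob 0 (sigma i) A) ->
  forall A, measurable A ->
    P ((fun w => \sum_(1 <= r < t.+1) delta i r w) @^-1` A) =
    normal_prob 0 (sigma i * Num.sqrt t%:R) A.
Proof.
move=> t0 si law; elim: t t0 => // -[_ _|t IH _] A mA.
  rewrite sqrtr1 mulr1 -(law 1%N)//; congr (P _).
  by apply/seteqP; split => w /=; rewrite big_nat1.
have ind := @mutually_independent_partial_sums t.+1 isT.
pose D := [set z : R * R | A (z.1 + z.2)].
have mD : measurable D.
  by rewrite -[D]setTI; exact: (measurable_funD measurable_fst measurable_snd).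
have := @probability_joint_event_pair _ _ _ P _ _ _
  (fun l _ => measurable_absorbed (fun=> t.+1) l) ind (i, 1%N) (i, t.+2)
  (normal_prob 0 (sigma i * Num.sqrt t.+1%:R)) (normal_prob 0 (sigma i)) [::]
  (fun=> setT) D.
rewrite (_ : joint_event _ _ _ = setT); last by apply/seteqP; split.
rewrite setTI probability_setT mul1e.
rewrite normal_prob_convolution ?mulr_gt0// => pairE.
rewrite (_ : sigma i * _ = Num.sqrt ((sigma i * Num.sqrt t.+1%:R) ^+ 2 + sigma i ^+ 2)).
  rewrite -pairE//=.
  - by congr (P _); apply/seteqP; split => w /=;
      rewrite /D /absorbed/= (big_nat_recr t.+2).
  - by rewrite xpair_eqE eqxx.
  - by rewrite /unabsorbed/= ltnSn.
  - by move=> B mB; rewrite -IH.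
  - by move=> B mB; rewrite -(law t.+2).
rewrite exprMn sqr_sqrtr// -{2}[sigma i ^+ 2]mulr1 -mulrDr natr1.
by rewrite sqrtrM ?sqr_ge0// sqrtr_sqr gtr0_norm.
Qed.

End partial_sums.

(** * Spread events *)

(** The law of the scaled differences is represented once with the scales [al], [be] and once with
    [- al], [- be]. The product, hence [rho], is the same, while the scaled differences change
    sign. *)
Lemma binormal_prob_opp (R : realType) (s1 s2 s3 : R) (C : set (R * R)) :
  0 < s1 -> 0 < s2 -> 0 < s3 -> measurable C ->
  let rho := s1 ^+ 2 /
    Num.sqrt ((s1 ^+ 2 + s2 ^+ 2) * (s1 ^+ 2 + s3 ^+ 2)) in
  binormal_prob rho [set z | C (- z.1, - z.2)] = binormal_prob rho C.
Proof.
move=> s1_gt0 s2_gt0 s3_gt0 mC rho.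
pose al := Num.sqrt (s1 ^+ 2 + s2 ^+ 2); pose be := Num.sqrt (s1 ^+ 2 + s3 ^+ 2).
have al0 : 0 < al by rewrite sqrtr_gt0 addr_gt0 ?exprn_gt0.
have be0 : 0 < be by rewrite sqrtr_gt0 addr_gt0 ?exprn_gt0.
have al2 : al ^+ 2 = s1 ^+ 2 + s2 ^+ 2 by rewrite sqr_sqrtr// addr_ge0 ?sqr_ge0.
have be2 : be ^+ 2 = s1 ^+ 2 + s3 ^+ 2 by rewrite sqr_sqrtr// addr_ge0 ?sqr_ge0.
have albe : 0 < al * be by exact: mulr_gt0.
have rhoE : rho = s1 ^+ 2 / (al * be).
  by rewrite /rho sqrtrM// addr_ge0 ?sqr_ge0.
have mCN : measurable [set z : R * R | C (- z.1, - z.2)].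
  rewrite -[X in measurable X]setTI.
  have mN : measurable_fun setT (fun z : R * R => (- z.1, - z.2)).
    by apply: measurable_fun_pair; exact: measurableT_comp.
  exact: mN.
rewrite rhoE -(normal_prob_product_binormal s1_gt0 s2_gt0 s3_gt0 albe al2 be2 mCN).
rewrite -[al * be]mulrNN -(normal_prob_product_binormal s1_gt0 s2_gt0 s3_gt0 _ _ _ mC).
- by congr (product_measure1 _ _ _); apply/seteqP; split => x /=; rewrite !invrN !mulrN.
- by rewrite mulrNN.
- by rewrite sqrrN.
- by rewrite sqrrN.
Qed.

Section has_expectation.
Context d (T : measurableType d) (R : realType) (P : probability T R).

(** Integrability is bundled with the value, so that linearity can be chained without side
    conditions. *)
Definition has_expectation (Y : T -> R) (e : R) :=
  Y \in Lfun P 1%E /\ ('E_P[Y] = e%:E)%E.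

Lemma has_expectationD Y1 Y2 e1 e2 : has_expectation Y1 e1 ->
  has_expectation Y2 e2 -> has_expectation (fun w => Y1 w + Y2 w) (e1 + e2).
Proof.
move=> [L1 E1] [L2 E2]; split; first exact: rpredD.
by rewrite EFinD -E1 -E2 -expectationD.
Qed.

Lemma has_expectationB Y1 Y2 e1 e2 : has_expectation Y1 e1 ->
  has_expectation Y2 e2 -> has_expectation (fun w => Y1 w - Y2 w) (e1 - e2).
Proof.
move=> [L1 E1] [L2 E2]; split; first exact: rpredB.
by rewrite EFinB -E1 -E2 -expectationB.
Qed.

Lemma ge0_has_expectation (Y : T -> R) e : measurable_fun setT Y ->
  (forall w, 0 <= Y w) -> (\int[P]_w (Y w)%:E = e%:E)%E -> has_expectation Y e.
Proof.
move=> mY Y0 YE; split; last by rewrite unlock.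
apply/Lfun1_integrable/integrableP; split; first exact/measurable_EFinP.
under eq_integral do rewrite gee0_abs ?lee_fin//.
by rewrite YE ltry.
Qed.

End has_expectation.

Section pair_returns.
Context d (T : measurableType d) (R : realType) (P : probability T R).
Variables (sigma : 'I_3 -> R) (delta : 'I_3 -> nat -> T -> R) (t : nat).
Hypothesis sigma_gt0 : forall i, 0 < sigma i.
Hypothesis mdelta : forall i s, measurable_fun setT (delta i s).
Hypothesis inddelta : mutually_independent P (fun j : 'I_3 * nat => (0 < j.2)%N)
  (fun j => delta j.1 j.2).
Hypothesis lawdelta : forall i s, (0 < s)%N -> forall A, measurable A ->
  P (delta i s @^-1` A) = normal_prob 0 (sigma i) A.
Hypothesis t_gt0 : (0 < t)%N.

Local Notation X i w := (\sum_(1 <= s < t.+1) delta i s w).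
Local Notation rho := (sigma stk1 ^+ 2 /
  Num.sqrt ((sigma stk1 ^+ 2 + sigma stk2 ^+ 2) *
            (sigma stk1 ^+ 2 + sigma stk3 ^+ 2))).
Local Notation al := (spread_sd sigma stk2 t).
Local Notation be := (spread_sd sigma stk3 t).

Lemma spread_sd_gt0 j : 0 < spread_sd sigma j t.
Proof. by rewrite sqrtr_gt0 mulr_gt0 ?ltr0n// addr_gt0 ?exprn_gt0. Qed.

Lemma spread_sd_sqr j : spread_sd sigma j t ^+ 2 =
  (sigma stk1 * Num.sqrt t%:R) ^+ 2 + (sigma j * Num.sqrt t%:R) ^+ 2.
Proof.
rewrite sqr_sqrtr ?mulr_ge0// ?addr_ge0 ?sqr_ge0//.
by rewrite !exprMn sqr_sqrtr// -mulrDl mulrC.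
Qed.

(** The factor [t] is common to all the variances and cancels, so the correlation does not depend on
    time. *)
Lemma spread_corr : (sigma stk1 * Num.sqrt t%:R) ^+ 2 / (al * be) = rho.
Proof.
have t0 : t%:R != 0 :> R by rewrite pnatr_eq0 -lt0n.
rewrite /spread_sd -sqrtrM ?mulr_ge0// ?addr_ge0 ?sqr_ge0//.
rewrite mulrACA -expr2 sqrtrM ?sqr_ge0// sqrtr_sqr ger0_norm// exprMn sqr_sqrtr//.
set r := Num.sqrt _; have r0 : r != 0.
  by rewrite gt_eqF// sqrtr_gt0 mulr_gt0 ?addr_gt0 ?exprn_gt0.
by field; rewrite r0 t0.
Qed.

Definition spread_event (C : set (R * R)) : set T :=
  [set w | C ((X stk2 w - X stk1 w) / al, (X stk3 w - X stk1 w) / be)].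

Let D C := [set x : R * (R * R) | C ((x.2.1 - x.1) / al, (x.2.2 - x.1) / be)].

Let mD C : measurable C -> measurable (D C).
Proof.
move=> mC; rewrite -[D C]setTI.
have mdiff (f : R * (R * R) -> R) (c : R) : measurable_fun setT f ->
    measurable_fun setT (fun x => (f x - x.1) / c).
  by move=> mf; apply: measurable_funM => //; exact: measurable_funB.
have mf : measurable_fun setT
    (fun x : R * (R * R) => ((x.2.1 - x.1) / al, (x.2.2 - x.1) / be)).
  apply: measurable_fun_pair; apply: mdiff.
    exact: measurableT_comp measurable_fst measurable_snd.
  exact: measurableT_comp measurable_snd measurable_snd.
exact: mf.
Qed.

Let ind := mutually_independent_partial_sums mdelta inddelta t_gt0.

Let lawX i := normal_partial_sum mdelta inddelta t_gt0 (sigma_gt0 i) (lawdelta i).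

(** The three sums up to [t] and the increments at [t.+1] belong to one independent family, so
    events of the next period factor out, and the triple of sums contributes the binormal law. *)
Let triple (J : seq ('I_3 * nat)) (B : 'I_3 * nat -> set R) C : uniq J ->
  (forall l, l \in J -> l.2 = t.+1 /\ measurable (B l)) -> measurable C ->
  P (joint_event (absorbed delta (fun=> t)) J B `&` spread_event C) =
  (P (joint_event (absorbed delta (fun=> t)) J B) * binormal_prob rho C)%E.
Proof.
move=> uJ JB mC.
(* Indices in [J] have second component [t.+1], which differs from 1 because [t] is positive. *)
have JE i : (i, 1%N) \notin J.
  by apply/negP => /JB[/= [t0] _]; have := t_gt0; rewrite -t0.
pose s i := sigma i * Num.sqrt t%:R.
have s0 i : 0 < s i by rewrite mulr_gt0// sqrtr_gt0 ltr0n.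
have albe : 0 < al * be by rewrite mulr_gt0 ?spread_sd_gt0.
rewrite -spread_corr -(normal_prob_product_binormal (s0 stk1) (s0 stk2) (s0 stk3)
  albe (spread_sd_sqr stk2) (spread_sd_sqr stk3) mC).
rewrite -(@probability_joint_event_triple _ _ _ P _ _ _
  (fun l _ => measurable_absorbed mdelta (fun=> t) l) ind
  (stk1, 1%N) (stk2, 1%N) (stk3, 1%N)) //.
- by rewrite /= !inE !JE uJ.
- exact: lawX.
- exact: lawX.
- exact: lawX.
- by move=> l /JB[l2 mBl]; split => //; rewrite /unabsorbed l2 ltnSn orbT.
- exact: mD.
Qed.

Lemma probability_spread_event C : measurable C ->
  P (spread_event C) = binormal_prob rho C.
Proof.
move=> mC; have := @triple [::] (fun=> setT) C isT.
rewrite (_ : joint_event _ _ _ = setT); last by apply/seteqP; split.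
by rewrite setTI probability_setT mul1e => ->.
Qed.

Lemma spread_event_independent C i j A B : i != j -> measurable C ->
  measurable A -> measurable B ->
  P (spread_event C `&` (delta i t.+1 @^-1` A `&` delta j t.+1 @^-1` B)) =
  (P (spread_event C) * (normal_prob 0 (sigma i) A * normal_prob 0 (sigma j) B))%E.
Proof.
move=> ij mC mA mB.
pose J := [:: (i, t.+1); (j, t.+1)].
pose B' (l : 'I_3 * nat) := if l.1 == i then A else B.
have t1 : (t.+1 == 1%N) = false by rewrite eqSS gtn_eqF.
have uJ : uniq J by rewrite /= inE xpair_eqE (negbTE ij).
have okJ l : l \in J -> l.2 = t.+1 /\ measurable (B' l).
  by rewrite !inE /B' => /orP[] /eqP -> /=; case: ifP.
have JE : joint_event (absorbed delta (fun=> t)) J B' =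
    delta i t.+1 @^-1` A `&` delta j t.+1 @^-1` B.
  rewrite !joint_event_cons /B' /= eqxx (eq_sym j) (negbTE ij) /absorbed /= t1.
  by rewrite (_ : joint_event _ _ _ = setT) ?setIT//; apply/seteqP; split.
rewrite setIC -JE triple// -probability_spread_event// muleC; congr (_ * _)%E.
rewrite -(@lawdelta i t.+1 isT A mA) -(@lawdelta j t.+1 isT B mB).
rewrite /joint_event ind//=; last first.
  by move=> l /okJ[l2 mBl]; split => //; rewrite /unabsorbed l2 ltnSn orbT.
by rewrite !big_cons big_nil mule1 /B' /= eqxx (eq_sym j) (negbTE ij) /absorbed /= t1.
Qed.

Lemma measurable_spread_event C : measurable C -> measurable (spread_event C).
Proof.
move=> mC; rewrite -[spread_event C]setTI.
have mX i : measurable_fun setT (fun w => X i w).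
  by apply: measurable_sum => s; exact: mdelta.
have mz : measurable_fun setT
    (fun w => ((X stk2 w - X stk1 w) / al, (X stk3 w - X stk1 w) / be)).
  by apply: measurable_fun_pair; apply: measurable_funM => //;
    exact: measurable_funB.
exact: mz.
Qed.

Lemma binormal_prob_fineK C : measurable C ->
  (fine (binormal_prob rho C))%:E = binormal_prob rho C.
Proof.
move=> mC; rewrite -probability_spread_event// fineK// fin_num_measure//.
exact: measurable_spread_event.
Qed.

(** The one moment formula behind the covariance: the coefficients [l] and [m] are later set to 0, 1
    or 2 to give means, mixed products and squares of gross returns. *)
Lemma has_expectation_spread_event C i j (c l m : R) : i != j -> measurable C ->
  has_expectation P (fun w => \1_(spread_event C) w *
      expR (c + l * delta i t.+1 w + m * delta j t.+1 w))
    (fine (binormal_prob rho C) *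
     expR (c + l ^+ 2 * sigma i ^+ 2 / 2 + m ^+ 2 * sigma j ^+ 2 / 2)).
Proof.
move=> ij mC; have mE := measurable_spread_event mC.
apply: ge0_has_expectation.
- apply: measurable_funM; first exact: measurable_indic.
  apply: measurableT_comp => //; apply: measurable_funD.
    by apply: measurable_funD => //; exact: measurable_funM.
  exact: measurable_funM.
- by move=> w; rewrite mulr_ge0 ?expR_ge0.
have mg (b r : R) : measurable_fun [set: R] (fun x : R => (expR (b + r * x))%:E).
  apply/measurable_EFinP; apply: measurableT_comp => //.
  by apply: measurable_funD => //; exact: measurable_funM.
have int (b r : R) n : (\int[normal_prob 0 (sigma n)]_x (expR (b + r * x))%:E =
    (expR (b + r ^+ 2 * sigma n ^+ 2 / 2))%:E)%E.
  under eq_integral do rewrite expRD EFinM.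
  rewrite ge0_integralZl_EFin ?expR_ge0//.
    by rewrite integral_normal_prob_expR// -EFinM -expRD.
  by have := mg 0 r; under eq_fun do rewrite add0r.
(* The indicator becomes the domain of integration, and the exponential splits into one factor per
   increment. The constant [c] goes to the first factor; the [0 +] in the second gives both the same
   shape. *)
transitivity (\int[P]_(w in spread_event C)
    ((expR (c + l * delta i t.+1 w))%:E * (expR (0 + m * delta j t.+1 w))%:E))%E.
  rewrite [RHS]integral_mkcond epatch_indic; apply: eq_integral => w _.
  by rewrite /= -!EFinM -expRD add0r mulrC.
rewrite (@integral_setI_pairM _ _ _ T (measurableTypeR R) (measurableTypeR R) R P
  (spread_event C) (delta i t.+1) (delta j t.+1) (normal_prob 0 (sigma i))
  (normal_prob 0 (sigma j)) mE _ _ _ (fun x => (expR (c + l * x))%:E)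
  (fun x => (expR (0 + m * x))%:E)).
- rewrite !int probability_spread_event// -binormal_prob_fineK// -!EFinM -expRD.
  by rewrite add0r.
- exact: mdelta.
- exact: mdelta.
- by move=> A B mA mB; exact: spread_event_independent.
- exact: mg.
- exact: mg.
- by move=> x; rewrite lee_fin expR_ge0.
- by move=> x; rewrite lee_fin expR_ge0.
Qed.

End pair_returns.

(** * Covariance of the pair returns *)

Section pair_covariance.
Context d (T : measurableType d) (R : realType) (P : probability T R).
Variables (c : R) (mu sigma : 'I_3 -> R) (k : R).
Variables (delta : 'I_3 -> nat -> T -> R) (t : nat).
Hypothesis sigma_gt0 : forall i, 0 < sigma i.
Hypothesis mdelta : forall i s, measurable_fun setT (delta i s).
Hypothesis inddelta : mutually_independent P (fun j : 'I_3 * nat => (0 < j.2)%N)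
  (fun j => delta j.1 j.2).
Hypothesis lawdelta : forall i s, (0 < s)%N -> forall A, measurable A ->
  P (delta i s @^-1` A) = normal_prob 0 (sigma i) A.
Hypothesis t_gt0 : (0 < t)%N.

Local Notation rho := (sigma stk1 ^+ 2 /
  Num.sqrt ((sigma stk1 ^+ 2 + sigma stk2 ^+ 2) *
            (sigma stk1 ^+ 2 + sigma stk3 ^+ 2))).
Local Notation event := (spread_event sigma delta t).
Local Notation prob C := (fine (binormal_prob rho C)).

Let gross i w : R := expR (mu i + delta i t.+1 w).
Let mean i : R := expR (mu i + sigma i ^+ 2 / 2).

Let has_expectationE C i j l m := @has_expectation_spread_event _ _ _ P _ _ _
  sigma_gt0 mdelta inddelta lawdelta t_gt0 C i j l m.

Lemma stock_returnE i w : stock_return c mu delta i t w = gross i w - 1.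
Proof.
rewrite /stock_return /price /logprice -expRN -expRD; congr (expR _ - 1).
by rewrite big_nat_recr//= -[t.+1%:R]natr1; ring.
Qed.

Lemma spreadE j w : spread c mu delta j t w =
  \sum_(1 <= s < t.+1) delta j s w - \sum_(1 <= s < t.+1) delta stk1 s w.
Proof. by rewrite /spread /price !expRK /logprice; ring. Qed.

(** In the covariance [f] is [fst] or [snd] and selects the normalised spread of one pair; [low]
    opens the long position, [high] the short one. *)
Let low (f : R * R -> R) := [set z | f z <= - k].
Let high (f : R * R -> R) := [set z | k <= f z].

Let mlow f : measurable_fun setT f -> measurable (low f).
Proof.
by move=> mf; rewrite -[low f]setTI; exact: measurable_fun_le (measurable_cst _).
Qed.

Lemma pair_returnE j f :
  (forall w, f ((\sum_(1 <= s < t.+1) delta stk2 s w -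
                 \sum_(1 <= s < t.+1) delta stk1 s w) / spread_sd sigma stk2 t,
                (\sum_(1 <= s < t.+1) delta stk3 s w -
                 \sum_(1 <= s < t.+1) delta stk1 s w) / spread_sd sigma stk3 t) =
     (\sum_(1 <= s < t.+1) delta j s w -
      \sum_(1 <= s < t.+1) delta stk1 s w) / spread_sd sigma j t) ->
  pair_return c mu sigma k delta j t = fun w =>
    (\1_(event (low f)) w - \1_(event (high f)) w) * (gross j w - gross stk1 w).
Proof.
move=> fE; apply/funext => w.
rewrite /pair_return !stock_returnE opprB addrA subrK; congr (_ * _).
rewrite /signal spreadE !indicE.
have sd0 := spread_sd_gt0 sigma_gt0 t_gt0 j.
congr (_%:R - _%:R); congr nat_of_bool; apply/idP/idP;
  rewrite !inE /spread_event /low /high /= fE;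
  by rewrite ?ler_pdivrMr ?ler_pdivlMr.
Qed.

Lemma has_expectation_event_gross C i : measurable C ->
  has_expectation P (fun w => \1_(event C) w * gross i w) (prob C * mean i).
Proof.
(* The moment formula wants two distinct stocks; any [j] other than [i] serves, with coefficient
   0. *)
move=> mC; pose j := if i == stk1 then stk2 else stk1.
have ij : i != j by rewrite /j; case: (i =P stk1) => [->|/eqP].
have := has_expectationE (mu i) 1 0 ij mC; congr (has_expectation _ _ _).
  by apply/funext => w; rewrite mul1r mul0r addr0.
by rewrite expr1n mul1r expr0n/= !mul0r addr0.
Qed.

Lemma has_expectation_event_gross2 C i j : i != j -> measurable C ->
  has_expectation P (fun w => \1_(event C) w * (gross i w * gross j w))
    (prob C * (mean i * mean j)).
Proof.
move=> ij mC.
have := has_expectationE (mu i + mu j) 1 1 ij mC; congr (has_expectation _ _ _).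
  by apply/funext => w; rewrite !mul1r -expRD; congr (_ * expR _); ring.
by rewrite expr1n !mul1r -expRD; congr (_ * expR _); ring.
Qed.

Lemma has_expectation_event_gross_sqr C i : measurable C ->
  has_expectation P (fun w => \1_(event C) w * gross i w ^+ 2)
    (prob C * expR (mu i *+ 2 + sigma i ^+ 2 *+ 2)).
Proof.
move=> mC; pose j := if i == stk1 then stk2 else stk1.
have ij : i != j by rewrite /j; case: (i =P stk1) => [->|/eqP].
have := has_expectationE (mu i *+ 2) 2 0 ij mC; congr (has_expectation _ _ _).
  apply/funext => w; rewrite mul0r addr0 expr2 -expRD; congr (_ * expR _).
  by ring.
by rewrite expr0n/= !mul0r addr0; congr (_ * expR _); field.
Qed.

Lemma has_expectation_event_return C j : measurable C ->
  has_expectation P (fun w => \1_(event C) w * (gross j w - gross stk1 w))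
    (prob C * (mean j - mean stk1)).
Proof.
move=> mC; have := has_expectationB (has_expectation_event_gross j mC)
  (has_expectation_event_gross stk1 mC).
by rewrite -mulrBr; congr (has_expectation _ _ _); apply/funext => w; ring.
Qed.

(** The expansion of the product of the two return differences. Only the shared stock occurs
    squared, so its last term is a second moment and not a product of means. *)
Let cross_mean : R := mean stk2 * mean stk3 - mean stk1 * mean stk3 -
  mean stk1 * mean stk2 + expR (mu stk1 *+ 2 + sigma stk1 ^+ 2 *+ 2).

Lemma has_expectation_event_cross C : measurable C ->
  has_expectation P (fun w => \1_(event C) w *
    ((gross stk2 w - gross stk1 w) * (gross stk3 w - gross stk1 w)))
    (prob C * cross_mean).
Proof.
move=> mC; have h := fun i j ij => @has_expectation_event_gross2 C i j ij mC.
have := has_expectationD (has_expectationB (has_expectationB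
  (h stk2 stk3 isT) (h stk1 stk3 isT)) (h stk1 stk2 isT))
  (has_expectation_event_gross_sqr stk1 mC).
rewrite -!mulrBr -mulrDr; congr (has_expectation _ _ _).
by apply/funext => w; ring.
Qed.

Lemma low_opp f : (forall z, f (- z.1, - z.2) = - f z) ->
  low f = [set z | high f (- z.1, - z.2)].
Proof.
by move=> fN; apply/seteqP; split => z /=; rewrite /low /high/= fN lerNr.
Qed.

Lemma high_opp f : (forall z, f (- z.1, - z.2) = - f z) ->
  high f = [set z | low f (- z.1, - z.2)].
Proof.
by move=> fN; apply/seteqP; split => z /=; rewrite /low /high/= fN lerN2.
Qed.

Let mhigh f : measurable_fun setT f -> measurable (high f).
Proof.
by move=> mf; rewrite -[high f]setTI; exact: measurable_fun_le (measurable_cst _) mf.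
Qed.

(** As [f] is odd, the symmetry of the binormal law gives [low f] and [high f] the same probability;
    the returns are independent of both events, so the two contributions cancel. *)
Lemma has_expectation_pair_return j (f : R * R -> R) : measurable_fun setT f ->
  (forall z, f (- z.1, - z.2) = - f z) ->
  has_expectation P (fun w =>
    (\1_(event (low f)) w - \1_(event (high f)) w) * (gross j w - gross stk1 w)) 0.
Proof.
move=> mf fN; have := has_expectationB
  (has_expectation_event_return j (mlow mf)) (has_expectation_event_return j (mhigh mf)).
rewrite low_opp// binormal_prob_opp// -?low_opp//; last exact: mhigh.
rewrite subrr; congr (has_expectation _ _ _).
by apply/funext => w; ring.
Qed.

Lemma event_setI C C' w : \1_(event C) w * \1_(event C') w = \1_(event (C `&` C')) w :> R.
Proof. by rewrite -[RHS]/(\1_(event C `&` event C') w) indicI. Qed.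

Lemma pair_return_covariance :
  covariance P (pair_return c mu sigma k delta stk2 t)
               (pair_return c mu sigma k delta stk3 t) =
  (2%:E *
   (binormal_prob rho [set z | (k <= z.1 /\ k <= z.2)%R] -
    binormal_prob rho [set z | (k <= z.1 /\ z.2 <= - k)%R]) *
   cross_mean%:E)%E.
Proof.
rewrite (pair_returnE (j := stk2) (f := fst))// (pair_returnE (j := stk3) (f := snd))//.
have [La Ea] := has_expectation_pair_return stk2 (@measurable_fst _ _ _ _) (fun=> erefl).
have [Lb Eb] := has_expectation_pair_return stk3 (@measurable_snd _ _ _ _) (fun=> erefl).
pose lf := low fst; pose ls := low snd; pose hf := high fst; pose hs := high snd.
have [mlf mls] : measurable lf /\ measurable ls by split; exact: mlow.
have [mhf mhs] : measurable hf /\ measurable hs by split; exact: mhigh.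
have h C C' (mC : measurable C) (mC' : measurable C') :=
  has_expectation_event_cross (measurableI _ _ mC mC').
(* The product of the signals is the alternating sum of four indicators: plus sign when both are low
   or both high, minus sign otherwise. *)
have := has_expectationB
  (has_expectationB (h _ _ mlf mls) (h _ _ mlf mhs))
  (has_expectationB (h _ _ mhf mls) (h _ _ mhf mhs)).
set Y := fun w => _; have -> : Y = (fun w =>
    ((\1_(event lf) w - \1_(event hf) w) * (gross stk2 w - gross stk1 w)) *
    ((\1_(event ls) w - \1_(event hs) w) * (gross stk3 w - gross stk1 w))).
  by apply/funext => w; rewrite /Y -!event_setI; ring.
(* Both means vanish, so the covariance is the expectation of the product. *)
move=> [Lab Eab]; rewrite covarianceE// Ea Eb mul0e sube0 [LHS]Eab.
(* The central symmetry pairs the four quadrants, which produces the factor 2. *)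
have -> : prob (lf `&` ls) = prob (hf `&` hs).
  rewrite -(binormal_prob_opp (s3 := sigma stk3) _ _ _ (measurableI _ _ mhf mhs))//.
  by rewrite /lf /ls (low_opp (f := fst))// (low_opp (f := snd)).
have -> : prob (lf `&` hs) = prob (hf `&` ls).
  rewrite -(binormal_prob_opp (s3 := sigma stk3) _ _ _ (measurableI _ _ mhf mls))//.
  by rewrite /lf (low_opp (f := fst))// {1}/hs (high_opp (f := snd)).
rewrite -[X in (_ * (binormal_prob _ X - _) * _)%E]/(hf `&` hs).
rewrite -[X in (_ * (_ - binormal_prob _ X) * _)%E]/(hf `&` ls).
have fK C (mC : measurable C) := binormal_prob_fineK sigma_gt0 mdelta inddelta
  lawdelta t_gt0 mC.
(* Both binormal probabilities are finite, so the remaining identity can be settled in [R]. *)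
rewrite -(fK (hf `&` hs)); last exact: measurableI.
rewrite -(fK (hf `&` ls)); last exact: measurableI.
by rewrite -EFinB -!EFinM; congr EFin; ring.
Qed.

End pair_covariance.

Unset Implicit Arguments.

Theorem theorem4 (d : measure_display) (T : measurableType d) (R : realType)
  (P : probability T R) (c : R) (mu sigma : 'I_3 -> R) (k : R)
  (delta : 'I_3 -> nat -> {RV P >-> R}) :
  (forall i, 0 < sigma i) -> 0 < k ->
  mutually_independent P (fun j : 'I_3 * nat => (0 < j.2)%N)
    (fun j => (delta j.1 j.2 : T -> R)) ->
  (forall i t, (0 < t)%N -> forall A, measurable A ->
     distribution P (delta i t) A = normal_prob 0 (sigma i) A) ->
  let dl := fun i t => (delta i t : T -> R) in
  let rho := sigma stk1 ^+ 2 /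
    Num.sqrt ((sigma stk1 ^+ 2 + sigma stk2 ^+ 2) *
              (sigma stk1 ^+ 2 + sigma stk3 ^+ 2)) in
  forall t : nat, (1 <= t)%N ->
  covariance P (pair_return c mu sigma k dl stk2 t)
               (pair_return c mu sigma k dl stk3 t) =
  (2%:E *
   (binormal_prob rho [set z | (k <= z.1 /\ k <= z.2)%R] -
    binormal_prob rho [set z | (k <= z.1 /\ z.2 <= - k)%R]) *
   (expR (mu stk2 + mu stk3 + sigma stk2 ^+ 2 / 2 + sigma stk3 ^+ 2 / 2)
    - expR (mu stk1 + mu stk3 + sigma stk1 ^+ 2 / 2 + sigma stk3 ^+ 2 / 2)
    - expR (mu stk1 + mu stk2 + sigma stk1 ^+ 2 / 2 + sigma stk2 ^+ 2 / 2)
    + expR (mu stk1 *+ 2 + sigma stk1 ^+ 2 *+ 2))%:E)%E.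
Proof.
move=> sigma_gt0 k0 ind law dl rho t t1.
have mdl i s : measurable_fun setT (dl i s) by exact: measurable_funP.
have := pair_return_covariance c mu k sigma_gt0 mdl ind law t1.
rewrite -/rho => ->; congr (_ * _)%E; congr EFin.
rewrite -!expRD; congr (expR _ - expR _ - expR _ + _); ring.
Qed.
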